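(* The localic topos $\widehat{\mathbf{D}}$ is equivalent to the category of sheaves of sets on the topological space $\mathbb{S}$, $$\widehat{\mathbf{D}}\simeq \mathrm{Sh}(\mathbb{S}),$$ where $\mathbb{S}$ is the set of all supernatural numbers, with open sets corresponding to the elements $S=\bigcup_i n_i\mathbb{N}^\times_+\in\mathbf{\Omega}$, the open set corresponding to $S$ being $$\mathbb{X}_l(S)=\mathbb{X}_l\Big(\bigcup_i n_i\mathbb{N}^\times_+\Big)=\{s\in\mathbb{S} : \exists i,\ n_i\mid s\}.$$
   Context: $\mathbb{N}^\times_+$ is the multiplicative monoid of strictly positive integers, and $\mathbf{\Omega}$ is the set of all its ideals (subsets, possibly empty, closed under taking multiples), each of the form $\bigcup_{i\in I} n_i\mathbb{N}^\times_+$. $\mathbf{D}$ is the poset category with one object $[k]$ for every integer $k\ge1$ and exactly one arrow $[k]\to[l]$ if $l\mid k$, none otherwise. $\widehat{\mathbf{D}}$ is the topos of presheaves of sets (contravariant functors $\mathbf{D}\to\mathrm{Sets}$). A supernatural number is a formal product $s=\prod_{p} p^{s_p}$ over all primes $p$ with $s_p\in\mathbb{N}\cup\{\infty\}$; they multiply by adding exponents, $\mathbb{N}^\times_+$ embeds via unique factorization, and $n\mid s$ means that every exponent of $n$ is at most the corresponding exponent of $s$. *)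

(* Defs.v *)
From HB Require Import structures.
From mathcomp Require Import all_boot all_classical topology.

Set Implicit Arguments.
Unset Strict Implicit.
Unset Printing Implicit Defensive.

Local Open Scope classical_set_scope.

(* Arrows are compared with Leibniz equality; functional extensionality and
   proof irrelevance (boolp) make it the usual equality of arrows. *)
Record category := Category {
  ob :> Type;
  hom : ob -> ob -> Type;
  idm : forall x, hom x x;
  compm : forall x y z, hom y z -> hom x y -> hom x z;
  compm_idl : forall x y (f : hom x y), compm (idm y) f = f;
  compm_idr : forall x y (f : hom x y), compm f (idm x) = f;
  compmA : forall x y z t (h : hom z t) (g : hom y z) (f : hom x y),
    compm h (compm g f) = compm (compm h g) f }.

Arguments hom {c} x y.
Arguments idm {c} x.
Arguments compm {c x y z} g f.

Definition isomorphic (C : category) (x y : C) : Prop :=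
  exists (f : hom x y) (g : hom y x), compm g f = idm x /\ compm f g = idm y.

Definition op_cat (C : category) : category :=
  @Category C (fun x y => hom y x) (fun x => idm x)
    (fun x y z g f => compm f g)
    (fun x y f => compm_idr f) (fun x y f => compm_idl f)
    (fun x y z t h g f => esym (compmA f g h)).

(* A type is a set in the homotopical sense since Prop is proof irrelevant, so
   the types of one fixed universe serve as the category of sets. *)
Definition Sets : category :=
  @Category Type (fun X Y => X -> Y) (fun X x => x) (fun X Y Z g f x => g (f x))
    (fun X Y f => erefl) (fun X Y f => erefl) (fun X Y Z T h g f => erefl).

Record functor (C D : category) := Functor {
  fob :> C -> D;
  farr : forall x y : C, hom x y -> hom (fob x) (fob y);
  farr_id : forall x, farr (idm x) = idm (fob x);
  farr_comp : forall x y z (g : hom y z) (f : hom x y),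
    farr (compm g f) = compm (farr g) (farr f) }.

Arguments farr {C D} F {x y} f : rename.

Definition id_functor (C : category) : functor C C :=
  @Functor C C (fun x => x) (fun x y f => f) (fun x => erefl)
    (fun x y z g f => erefl).

Definition comp_functor (C D E : category) (G : functor D E) (F : functor C D) :
  functor C E :=
  @Functor C E (fun x => G (F x)) (fun x y f => farr G (farr F f))
    (fun x => etrans (congr1 (farr G) (farr_id F x)) (farr_id G (F x)))
    (fun x y z g f =>
       etrans (congr1 (farr G) (farr_comp F g f))
              (farr_comp G (farr F g) (farr F f))).

Record nat_trans (C D : category) (F G : functor C D) := NatTrans {
  ntc :> forall x : C, hom (F x) (G x);
  ntcP : forall x y (f : hom x y),
    compm (ntc y) (farr F f) = compm (farr G f) (ntc x) }.

Lemma nat_trans_eq (C D : category) (F G : functor C D) (s t : nat_trans F G) :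
  (forall x, s x = t x) -> s = t.
Proof.
case: s t => [s sP] [t tP] /= st.
have {}st : s = t by apply: functional_extensionality_dep.
by subst t; congr NatTrans; exact: Prop_irrelevance.
Qed.

Definition nt_id (C D : category) (F : functor C D) : nat_trans F F.
Proof.
exists (fun x => idm (F x)) => x y f.
by rewrite compm_idl compm_idr.
Defined.

Definition nt_comp (C D : category) (F G H : functor C D)
  (t : nat_trans G H) (s : nat_trans F G) : nat_trans F H.
Proof.
exists (fun x => compm (t x) (s x)) => x y f.
by rewrite -compmA ntcP compmA ntcP compmA.
Defined.

Definition functor_cat (C D : category) : category.
Proof.
refine (@Category (functor C D) (@nat_trans C D) (@nt_id C D) (@nt_comp C D)
  _ _ _).
- by move=> F G s; apply: nat_trans_eq => x /=; rewrite compm_idl.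
- by move=> F G s; apply: nat_trans_eq => x /=; rewrite compm_idr.
- by move=> F G H K u t s; apply: nat_trans_eq => x /=; rewrite compmA.
Defined.

Definition full_subcat (C : category) (P : C -> Prop) : category :=
  @Category {x : C | P x} (fun x y => hom (sval x) (sval y))
    (fun x => idm (sval x)) (fun x y z g f => compm g f)
    (fun x y f => compm_idl f) (fun x y f => compm_idr f)
    (fun x y z t h g f => compmA h g f).

Definition equivalent_categories (C D : category) : Prop :=
  exists (F : functor C D) (G : functor D C),
    @isomorphic (functor_cat C C) (comp_functor G F) (id_functor C) /\
    @isomorphic (functor_cat D D) (comp_functor F G) (id_functor D).

Definition presheaves (C : category) : category := functor_cat (op_cat C) Sets.

Record opens (T : topologicalType) := Opens {
  opens_set :> set T;
  opens_open : open opens_set }.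

Definition opens_cat (T : topologicalType) : category :=
  @Category (opens T) (fun U V => (U `<=` V : Prop)) (fun U => @subset_refl _ U)
    (fun U V W VW UV => subset_trans UV VW)
    (fun U V f => Prop_irrelevance _ _) (fun U V f => Prop_irrelevance _ _)
    (fun U V W X h g f => Prop_irrelevance _ _).

Definition opensI (T : topologicalType) (U V : opens T) : opens T :=
  Opens (openI (opens_open U) (opens_open V)).

(* `restr F UV s` is the restriction to U of the section s over V. *)
Definition restr (T : topologicalType) (F : presheaves (opens_cat T))
    (U V : opens T) (UV : U `<=` V) : F V -> F U :=
  @farr (op_cat (opens_cat T)) Sets F V U UV.

Arguments restr {T} F {U V} UV.

Definition is_sheaf (T : topologicalType) (F : presheaves (opens_cat T)) : Prop :=
  forall (I : Type) (W : I -> opens T) (U : opens T)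
         (WU : forall i, W i `<=` U),
    U `<=` \bigcup_i W i ->
  forall s : forall i, F (W i),
    (forall i j,
       restr F (U := opensI (W i) (W j)) (@subIsetl _ _ _) (s i) =
       restr F (U := opensI (W i) (W j)) (@subIsetr _ _ _) (s j)) ->
    exists! t : F U, forall i, restr F (WU i) t = s i.

Definition sheaves (T : topologicalType) : category :=
  full_subcat (@is_sheaf T).

Definition posnat := {n : nat | 0 < n}.

Definition multiples (n : posnat) : set posnat :=
  [set m | val n %| val m].

Definition Omega : set (set posnat) :=
  [set S | forall n m : posnat, S n -> val n %| val m -> S m].

Definition D_cat : category :=
  @Category posnat (fun k l => is_true (val l %| val k))
    (fun k => dvdnn (val k)) (fun k l m ml lk => dvdn_trans ml lk)
    (fun k l f => Prop_irrelevance _ _) (fun k l f => Prop_irrelevance _ _)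
    (fun k l m n h g f => Prop_irrelevance _ _).

(* In an exponent, None stands for infinity. *)
Record supernatural := Supernatural {
  sexp : {p : nat | prime p} -> option nat }.

Definition exp_le (a b : option nat) : bool :=
  match a, b with
  | _, None => true
  | None, Some _ => false
  | Some m, Some n => m <= n
  end.

Definition sdvd (s t : supernatural) : Prop :=
  forall p, exp_le (sexp s p) (sexp t p).

Definition super_of_nat (n : posnat) : supernatural :=
  Supernatural (fun p => Some (logn (val p) (val n))).

(* An ideal is the union of the multiples of all its elements; the set does not
   depend on the choice of generators. *)
Definition X_l (S : set posnat) : set supernatural :=
  [set s | exists2 n, S n & sdvd (super_of_nat n) s].

Lemma X_l_setT : X_l setT = setT.
Proof.
apply/seteqP; split => // s _; exists (exist (fun k => 0 < k) 1 isT) => // p.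
by rewrite /= logn1; case: (sexp s p).
Qed.

Lemma X_lI (S S' : set posnat) : Omega S -> Omega S' ->
  X_l S `&` X_l S' = X_l (S `&` S').
Proof.
move=> OS OS'; apply/seteqP; split => s; last first.
  by move=> [n [Sn S'n] ns]; split; exists n.
move=> [[n Sn ns] [m Sm ms]].
have lcm_gt0 : 0 < lcmn (val n) (val m) by rewrite lcmn_gt0 (valP n) (valP m).
exists (exist (fun k => 0 < k) _ lcm_gt0).
  by split; [apply: (OS n) | apply: (OS' m)]; rewrite //= ?dvdn_lcml ?dvdn_lcmr.
move=> p; move: (ns p) (ms p).
rewrite /= logn_lcm ?(valP n) ?(valP m) //.
by case: (sexp s p) => //= e en em; rewrite geq_max en em.
Qed.

Definition supernatural_open : set (set supernatural) :=
  [set U | exists2 S, Omega S & U = X_l S].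

Lemma supernatural_openT : supernatural_open setT.
Proof. by exists setT => //; rewrite X_l_setT. Qed.

Lemma supernatural_openI : setI_closed supernatural_open.
Proof.
move=> _ _ [S OS ->] [S' OS' ->]; exists (S `&` S'); last exact: X_lI.
by move=> n m [Sn S'n] nm; split; [apply: OS nm | apply: OS' nm].
Qed.

Lemma supernatural_open_bigU (I : Type) (f : I -> set supernatural) :
  (forall i, supernatural_open (f i)) -> supernatural_open (\bigcup_i f i).
Proof.
move=> fO.
exists [set n | exists i S, [/\ Omega S, f i = X_l S & S n]].
  move=> n m [i [S [OS fS Sn]]] nm; exists i, S; split => //; exact: OS nm.
apply/seteqP; split => s.
  move=> [i _ fis]; have [S OS fS] := fO i.
  by move: fis; rewrite fS => -[n Sn ns]; exists n => //; exists i, S.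
by move=> [n [i [S [OS fS Sn]]] ns]; exists i => //; rewrite fS; exists n.
Qed.

HB.instance Definition _ := gen_eqMixin supernatural.
HB.instance Definition _ := gen_choiceMixin supernatural.
HB.instance Definition _ := isOpenTopological.Build supernatural
  supernatural_openT supernatural_openI supernatural_open_bigU.

(* Main.v *)
Require Import Defs.
From mathcomp Require Import all_boot all_classical topology.

(** A positive integer n, seen as a supernatural number, has a smallest open
    neighbourhood [basic n], the set of its supernatural multiples. An open set
    is the union of the [basic n] for the integers n that it contains, so it is
    determined by these integers, which form an ideal. This gives the bijection
    between ideals and open sets ([X_l_bij]).

    For the equivalence, [n |-> basic n] is a functor from D to the open sets
    ([basic_functor]), and restricting sheaves along it gives a functor from
    sheaves on S to presheaves on D. Its inverse sends a presheaf P to the sheaf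
    whose sections over V are the compatible families of elements of P n, for n
    an integer in V ([sections]). Some member of every covering of a
    neighbourhood of n contains n, hence all of [basic n]: there are no
    nontrivial coverings of [basic n], so that every presheaf P is allowed, and
    matching sections glue entry by entry ([glue_sheaf]).

    The two functors are inverse to each other for the following reasons. Over
    [basic n] a compatible family is determined by its entry at n, which can be
    arbitrary ([eval_bij]). Conversely, the [basic n] with n in V cover V, and a
    compatible family of sections of a sheaf over them is a matching family for
    this covering, so it comes from exactly one section over V ([germs_bij]). *)

Set Implicit Arguments.
Unset Strict Implicit.
Unset Printing Implicit Defensive.

Local Open Scope classical_set_scope.

(** * Isomorphisms in functor categories *)

Definition is_iso (C : category) (x y : C) (f : hom x y) : Prop :=
  exists g : hom y x, compm g f = idm x /\ compm f g = idm y.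

Lemma is_iso_isomorphic (C : category) (x y : C) (f : hom x y) :
  is_iso f -> isomorphic x y.
Proof. by move=> fiso; exists f. Qed.

Lemma is_iso_isomorphic_sym (C : category) (x y : C) (f : hom x y) :
  is_iso f -> isomorphic y x.
Proof. by move=> [g [gf fg]]; exists g, f. Qed.

Lemma bijective_is_iso (X Y : Sets) (f : hom X Y) : bijective f -> is_iso f.
Proof.
by move=> [g fK gK]; exists g; split; apply: functional_extensionality_dep.
Qed.

(** The chosen inverses of the components are automatically natural. *)
Lemma pointwise_is_iso (C D : category) (F G : functor C D)
    (t : nat_trans F G) :
  (forall x, is_iso (t x)) -> @is_iso (functor_cat C D) F G t.
Proof.
move=> tiso; pose u x := sval (cid (tiso x)).
have uP x : compm (u x) (t x) = idm (F x) /\ compm (t x) (u x) = idm (G x).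
  exact: (svalP (cid (tiso x))).
have uN x y (f : hom x y) : compm (u y) (farr G f) = compm (farr F f) (u x).
  rewrite -[LHS]compm_idr -(uP x).2 -compmA (compmA (farr G f)) -ntcP.
  by rewrite -compmA compmA (uP y).1 compm_idl.
by exists (NatTrans uN); split; apply: nat_trans_eq => x; have [] := uP x.
Qed.

Lemma unique_preimage_bij (X Y : Type) (f : X -> Y) :
  (forall y, exists! x, f x = y) -> bijective f.
Proof.
move=> fU; have [g gP] := choice fU.
exists g => [x|y]; last exact: (gP y).1.
exact: (gP (f x)).2.
Qed.

Lemma sub_family_eq (I : Type) (A : I -> Prop) (T : I -> Type)
    (Q : (forall i, A i -> T i) -> Prop) (x y : {x | Q x}) :
  (forall i a, sval x i a = sval y i a) -> x = y.
Proof.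
case: x y => [x xQ] [y yQ] /= xy.
have {}xy : x = y.
  apply: functional_extensionality_dep => i.
  exact: functional_extensionality_dep.
by subst y; congr exist; exact: Prop_irrelevance.
Qed.

Lemma presheaf_id (C : category) (P : presheaves C) (x : C) (f : hom x x) e :
  f = idm x -> @farr (op_cat C) Sets P x x f e = e.
Proof. by move=> ->; rewrite (@farr_id (op_cat C) Sets P x). Qed.

Lemma presheaf_comp (C : category) (P : presheaves C) (x y z : C)
    (g : hom y z) (f : hom x y) (h : hom x z) e : h = compm g f ->
  @farr (op_cat C) Sets P y x f (@farr (op_cat C) Sets P z y g e) =
  @farr (op_cat C) Sets P z x h e.
Proof. by move=> ->; rewrite (@farr_comp (op_cat C) Sets P z y x f g). Qed.

Lemma presheaf_nat (C : category) (P Q : presheaves C) (t : hom P Q) (x y : C)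
    (f : hom x y) e :
  ntc t x (@farr (op_cat C) Sets P y x f e) =
  @farr (op_cat C) Sets Q y x f (ntc t y e).
Proof. exact: (congr1 (fun h => h e) (@ntcP _ _ _ _ t y x f)). Qed.

(** * Open sets of supernatural numbers *)

(** This lets [V s] stand for membership of s in an open set V. *)
Identity Coercion pred_of_set : set >-> Funclass.

Lemma exp_le_trans b a c : exp_le a b -> exp_le b c -> exp_le a c.
Proof. by case: a b c => [a|] [b|] [c|] //=; exact: leq_trans. Qed.

Lemma sdvd_trans t s u : sdvd s t -> sdvd t u -> sdvd s u.
Proof. by move=> st tu p; exact: exp_le_trans (st p) (tu p). Qed.

Lemma super_of_nat_dvd (n m : posnat) :
  sdvd (super_of_nat n) (super_of_nat m) <-> val n %| val m.
Proof.
split=> [nm|nm p]; last exact: (dvdn_leq_log _ (valP m) nm).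
apply/(dvdn_partP _ (valP n)) => p; rewrite mem_primes => /andP[p_pr _].
rewrite p_part pfactor_dvdn ?(valP m) //.
exact: (nm (exist _ p p_pr)).
Qed.

Lemma sdvd_refl_nat n : sdvd (super_of_nat n) (super_of_nat n).
Proof. exact/super_of_nat_dvd. Qed.

Lemma X_l_nat (S : set posnat) n : Omega S -> X_l S (super_of_nat n) <-> S n.
Proof.
move=> OS; split=> [[m Sm /super_of_nat_dvd mn]|Sn]; first exact: OS mn.
by exists n => //; exact: sdvd_refl_nat.
Qed.

Lemma Omega_multiples (I : Type) (n : I -> posnat) :
  Omega (\bigcup_i multiples (n i)).
Proof. by move=> k m [i _ ik] km; exists i => //; exact: dvdn_trans ik km. Qed.

Lemma X_l_multiples (I : Type) (n : I -> posnat) :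
  X_l (\bigcup_i multiples (n i)) =
  [set s | exists i, sdvd (super_of_nat (n i)) s].
Proof.
apply/seteqP; split=> s.
  move=> [m [i _ nm] ms]; exists i.
  by apply: sdvd_trans ms; exact/super_of_nat_dvd.
by move=> [i ns]; exists (n i) => //; exists i => //; exact: dvdnn.
Qed.

Lemma openX_l (U : set supernatural) :
  open U = exists2 S, Omega S & U = X_l S.
Proof. by []. Qed.

Lemma X_l_bij : set_bij Omega (@open supernatural) X_l.
Proof.
split=> [S OS|S S' /set_mem OS /set_mem OS' SS'|U].
- by rewrite openX_l; exists S.
- apply/seteqP; split=> n Sn.
    by apply/(X_l_nat _ OS'); rewrite -SS'; exact/X_l_nat.
  by apply/(X_l_nat _ OS); rewrite SS'; exact/X_l_nat.
- by rewrite openX_l => -[S OS ->]; exists S.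
Qed.

Definition basic_set (n : posnat) : set supernatural :=
  [set s | sdvd (super_of_nat n) s].

Lemma basic_open n : open (basic_set n).
Proof.
rewrite openX_l; exists (\bigcup_(_ in [set: unit]) multiples n).
  exact: (@Omega_multiples unit (fun=> n)).
rewrite (@X_l_multiples unit (fun=> n)).
by apply/seteqP; split=> s; [exists tt | case].
Qed.

Definition basic (n : posnat) : opens supernatural := Opens (@basic_open n).

Lemma basic_nat n m : basic n (super_of_nat m) <-> val n %| val m.
Proof. exact: super_of_nat_dvd. Qed.

Lemma basic_self n : basic n (super_of_nat n).
Proof. exact: sdvd_refl_nat. Qed.

Lemma opens_ideal (V : opens supernatural) :
  exists2 S, Omega S & opens_set V = X_l S.
Proof. by have := opens_open V; rewrite openX_l. Qed.

(** An open set X_l S contains n only if some m in S divides n, and then it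
    contains all supernatural multiples of n: they are multiples of m. *)
Lemma basic_sub (V : opens supernatural) n :
  V (super_of_nat n) -> basic n `<=` V.
Proof.
have [S OS ->] := opens_ideal V; move=> [m Sm mn] s ns.
by exists m => //; exact: sdvd_trans mn ns.
Qed.

Lemma open_cover_basic (V : opens supernatural) s :
  V s -> exists2 n, V (super_of_nat n) & basic n s.
Proof.
have [S OS ->] := opens_ideal V; move=> [n Sn ns].
by exists n => //; exact/X_l_nat.
Qed.

Lemma open_nat_dvd (V : opens supernatural) (n m : posnat) :
  V (super_of_nat n) -> val n %| val m -> V (super_of_nat m).
Proof. by move=> Vn nm; apply: (basic_sub Vn); exact/basic_nat. Qed.

Lemma basic_homo (k l : posnat) : val l %| val k -> basic k `<=` basic l.
Proof. by move=> lk; apply: basic_sub; exact/basic_nat. Qed.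

(** * Restricting sheaves to the basic open sets *)

Lemma D_thin (k l : D_cat) (f g : hom k l) : f = g.
Proof. exact: (@Prop_irrelevance (val l %| val k)). Qed.

Lemma opens_thin (T : topologicalType) (U V : opens_cat T) (f g : hom U V) :
  f = g.
Proof. exact: (@Prop_irrelevance (opens_set U `<=` opens_set V)). Qed.

Lemma restr_comp (T : topologicalType) (H : presheaves (opens_cat T))
    (U V W : opens T) (UV : U `<=` V) (VW : V `<=` W) (UW : U `<=` W)
    (h : H W) :
  restr H UV (restr H VW h) = restr H UW h.
Proof. by apply: presheaf_comp; exact: opens_thin. Qed.

Definition basic_functor : functor D_cat (opens_cat supernatural) :=
  @Functor D_cat (opens_cat supernatural) basic basic_homo
    (fun _ => opens_thin _ _) (fun _ _ _ _ _ => opens_thin _ _).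

Section Precomposition.
Variables (C D : category) (E : functor C D).

Definition op_functor : functor (op_cat C) (op_cat D) :=
  @Functor (op_cat C) (op_cat D) E (fun x y f => @farr _ _ E y x f)
    (fun x => farr_id E x) (fun x y z g f => farr_comp E f g).

Definition precomp_arr (P Q : presheaves D) (t : hom P Q) :
  @hom (presheaves C) (comp_functor P op_functor) (comp_functor Q op_functor) :=
  @NatTrans _ _ (comp_functor P op_functor) (comp_functor Q op_functor)
    (fun x => ntc t (E x)) (fun x y f => ntcP t (farr op_functor f)).

Definition precomp : functor (presheaves D) (presheaves C).
Proof.
exists (fun P => comp_functor P op_functor : presheaves C) precomp_arr.
- by move=> P; apply: nat_trans_eq.
- by move=> P Q R t s; apply: nat_trans_eq.
Defined.

End Precomposition.

Definition full_subcat_incl (C : category) (A : C -> Prop) :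
  functor (full_subcat A) C :=
  @Functor (full_subcat A) C (fun x => sval x) (fun x y f => f)
    (fun=> erefl) (fun _ _ _ _ _ => erefl).

Definition restrict_basic : functor (sheaves supernatural) (presheaves D_cat) :=
  comp_functor (precomp basic_functor) (full_subcat_incl _).

(** * The sheaf of compatible families *)

Definition compatible (P : presheaves D_cat) (V : opens supernatural)
    (x : forall n, V (super_of_nat n) -> P n) : Prop :=
  forall (n m : posnat) (Vn : V (super_of_nat n)) (Vm : V (super_of_nat m))
    (nm : val n %| val m),
    @farr (op_cat D_cat) Sets P n m nm (x n Vn) = x m Vm.

Definition sections (P : presheaves D_cat) (V : opens supernatural) : Type :=
  {x : forall n, V (super_of_nat n) -> P n | compatible x}.

Lemma section_irrelevance (P : presheaves D_cat) (V : opens supernatural)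
    (x : sections P V) n (Vn Vn' : V (super_of_nat n)) :
  sval x n Vn = sval x n Vn'.
Proof. by congr (sval x n _); exact: Prop_irrelevance. Qed.

Definition sections_restr (P : presheaves D_cat) (V U : opens supernatural)
    (UV : U `<=` V) (x : sections P V) : sections P U :=
  exist (@compatible P U) (fun n Un => sval x n (UV _ Un))
    (fun n m Un Um nm => svalP x n m (UV _ Un) (UV _ Um) nm).

Definition sections_presheaf (P : presheaves D_cat) :
  presheaves (opens_cat supernatural).
Proof.
exists (sections P : op_cat (opens_cat supernatural) -> Sets)
  (@sections_restr P).
- move=> V; apply: functional_extensionality_dep => x.
  by apply: sub_family_eq => n Vn /=; exact: section_irrelevance.
- move=> V U W g f; apply: functional_extensionality_dep => x.
  by apply: sub_family_eq => n Vn /=; exact: section_irrelevance.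
Defined.

(** The entry at n of the glued family is that of any member of the covering
    that contains n; the members that contain n agree there because their
    intersection contains n. *)
Lemma glue_sheaf (P : presheaves D_cat) : is_sheaf (sections_presheaf P).
Proof.
move=> I W U WU cov s sC.
have idx n : U (super_of_nat n) -> {i | W i (super_of_nat n)}.
  by move=> Un; apply: cid; have [i _ Wi] := cov _ Un; exists i.
have agree n i j (Wi : W i (super_of_nat n)) (Wj : W j (super_of_nat n)) :
    sval (s i) n Wi = sval (s j) n Wj.
  have := congr1 (fun x : sections P (opensI (W i) (W j)) =>
    sval x n (conj Wi Wj)) (sC i j) => /=.
  by rewrite (section_irrelevance _ _ Wi) (section_irrelevance _ _ Wj).
pose t0 n Un := sval (s (sval (idx n Un))) n (svalP (idx n Un)).
have t0C : @compatible P U t0.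
  move=> n m Un Um nm; rewrite /t0.
  have Wm := open_nat_dvd (svalP (idx n Un)) nm.
  by rewrite (svalP (s _) n m _ Wm); exact: agree.
exists (exist _ t0 t0C); split=> [i|t' t'P].
  by apply: sub_family_eq => n Wn; exact: agree.
apply: sub_family_eq => n Un /=; rewrite /t0 -t'P /=.
exact: section_irrelevance.
Qed.

Definition sections_sheaf (P : presheaves D_cat) : sheaves supernatural :=
  exist _ (sections_presheaf P) (@glue_sheaf P).

Lemma map_compatible (P Q : presheaves D_cat) (t : hom P Q)
    (V : opens supernatural) (x : sections P V) :
  @compatible Q V (fun n Vn => ntc t n (sval x n Vn)).
Proof. by move=> n m Vn Vm nm; rewrite -presheaf_nat (svalP x n m Vn Vm). Qed.

Definition sections_map (P Q : presheaves D_cat) (t : hom P Q) :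
  @hom (sheaves supernatural) (sections_sheaf P) (sections_sheaf Q).
Proof.
exists (fun V (x : sections P V) =>
          exist (@compatible Q V) _ (map_compatible t x) : sections Q V).
move=> V U UV; apply: functional_extensionality_dep => x.
exact: sub_family_eq.
Defined.

Definition sections_functor :
  functor (presheaves D_cat) (sheaves supernatural).
Proof.
exists sections_sheaf sections_map.
- move=> P; apply: nat_trans_eq => V.
  by apply: functional_extensionality_dep => x; exact: sub_family_eq.
- move=> P Q R g f; apply: nat_trans_eq => V.
  by apply: functional_extensionality_dep => x; exact: sub_family_eq.
Defined.

(** * A presheaf is recovered from its families over basic open sets *)

Definition eval (P : presheaves D_cat) (n : posnat) (x : sections P (basic n)) :
  P n := sval x n (basic_self n).
Arguments eval P n x : clear implicits.

(** The entry at n extends uniquely to [basic n], by restriction along the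
    divisibilities n %| m. *)
Lemma eval_bij (P : presheaves D_cat) n : bijective (eval P n).
Proof.
have dvd m : basic n (super_of_nat m) -> val n %| val m by move/basic_nat.
have extC e : @compatible P (basic n)
    (fun m nm => @farr (op_cat D_cat) Sets P n m (dvd m nm) e).
  by move=> k m nk nm km; apply: presheaf_comp; exact: D_thin.
exists (fun e => exist _ _ (extC e)) => [x|e].
  by apply: sub_family_eq => m nm; exact: (svalP x).
by apply: presheaf_id; exact: D_thin.
Qed.

Definition eval_presheaf (P : presheaves D_cat) :
  @hom (presheaves D_cat)
    (comp_functor restrict_basic sections_functor P) P.
Proof.
exists (eval P) => n m nm.
by apply: functional_extensionality_dep => x; apply/esym/(svalP x).
Defined.

Definition eval_trans :
  nat_trans (comp_functor restrict_basic sections_functor)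
    (id_functor (presheaves D_cat)).
Proof. by exists eval_presheaf => P Q t; apply: nat_trans_eq. Defined.

Lemma eval_trans_iso :
  @is_iso (functor_cat (presheaves D_cat) (presheaves D_cat)) _ _ eval_trans.
Proof.
apply: pointwise_is_iso => P; apply: pointwise_is_iso => n.
exact/bijective_is_iso/eval_bij.
Qed.

(** * A sheaf is recovered from its values on basic open sets *)

Section Germs.
Variable H : presheaves (opens_cat supernatural).

Lemma precomp_basicE (n m : posnat) (nm : val n %| val m) (e : H (basic n)) :
  @farr (op_cat D_cat) Sets (precomp basic_functor H) n m nm e =
  restr H (U := basic m) (V := basic n) (basic_homo nm) e.
Proof. by []. Qed.

Lemma germs_compatible (V : opens supernatural) (h : H V) :
  @compatible (precomp basic_functor H) V
    (fun n Vn => restr H (U := basic n) (basic_sub Vn) h).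
Proof.
by move=> n m Vn Vm nm; rewrite precomp_basicE (restr_comp _ _ (basic_sub Vm)).
Qed.

(** Restriction of a section to [basic n] plays the role of its germ at n,
    [basic n] being the smallest neighbourhood of n. *)
Definition germs (V : opens supernatural) (h : H V) :
  sections (precomp basic_functor H) V :=
  exist _ _ (germs_compatible h).

Hypothesis Hsheaf : is_sheaf H.

Lemma basic_cover (V : opens supernatural) :
  V `<=` \bigcup_(i : {n | V (super_of_nat n)}) basic (sval i).
Proof. by move=> s /open_cover_basic[n Vn ns]; exists (exist _ n Vn). Qed.

(** A sheaf is separated for the covering of V by the [basic n]. *)
Lemma germs_inj (V : opens supernatural) : injective (@germs V).
Proof.
move=> a b ab.
pose WV (i : {n | V (super_of_nat n)}) := basic_sub (proj2_sig i).
have [|h [_ hU]] := Hsheaf WV (@basic_cover V) (s := fun i => restr H (WV i) a).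
  move=> i j; pose UV := subset_trans (@subIsetl _ (basic (sval i))
                           (basic (sval j))) (WV i).
  by transitivity (restr H (U := opensI _ _) UV a); [|symmetry];
    exact: restr_comp.
rewrite -(hU a) // (hU b) // => i.
exact: (congr1 (fun x : sections _ _ => sval x _ (proj2_sig i)) (esym ab)).
Qed.

(** A family compatible along divisibility is a matching family for the cover
    by the [basic n]: the entries at n and m have the same germs at every k in
    [basic n `&` basic m], namely the entry at k. *)
Lemma germs_bij (V : opens supernatural) : bijective (@germs V).
Proof.
apply: unique_preimage_bij => x.
pose WV (i : {n | V (super_of_nat n)}) := basic_sub (proj2_sig i).
have [|h [hP _]] :=
    Hsheaf WV (@basic_cover V) (s := fun i => sval x _ (proj2_sig i)).
  move=> i j; apply: germs_inj; apply: sub_family_eq => k [ik jk] /=.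
  have Vk : V (super_of_nat k) := WV i _ ik.
  transitivity (sval x k Vk); [|symmetry].
    rewrite -(svalP x _ _ (proj2_sig i) Vk ((basic_nat _ _).1 ik)).
    exact: restr_comp.
  rewrite -(svalP x _ _ (proj2_sig j) Vk ((basic_nat _ _).1 jk)).
  exact: restr_comp.
have hx : germs h = x.
  (* The opaque [svalP] in place of [proj2_sig] would block the conversion. *)
  by apply: sub_family_eq => n Vn; exact: (hP (exist _ n Vn)).
by exists h; split=> // h' h'x; apply: germs_inj; rewrite hx h'x.
Qed.

End Germs.

Definition germs_sheaf (H : sheaves supernatural) :
  @hom (sheaves supernatural) H
    (comp_functor sections_functor restrict_basic H).
Proof.
exists (@germs (sval H)) => V U UV.
apply: functional_extensionality_dep => h; apply: sub_family_eq => n Un /=.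
exact: restr_comp.
Defined.

Definition germs_trans :
  nat_trans (id_functor (sheaves supernatural))
    (comp_functor sections_functor restrict_basic).
Proof.
exists germs_sheaf => H K t; apply: nat_trans_eq => V.
apply: functional_extensionality_dep => h; apply: sub_family_eq => n Vn /=.
exact/esym/presheaf_nat.
Defined.

Lemma germs_trans_iso :
  @is_iso (functor_cat (sheaves supernatural) (sheaves supernatural)) _ _
    germs_trans.
Proof.
apply: pointwise_is_iso => -[H Hsh].
apply: (@pointwise_is_iso _ _ _ _ (germs_sheaf (exist _ H Hsh))) => V.
exact/bijective_is_iso/germs_bij.
Qed.

Theorem theorem1 :
  [/\ (forall (I : Type) (n : I -> posnat),
         Omega (\bigcup_i multiples (n i)) /\
         X_l (\bigcup_i multiples (n i)) =
           [set s | exists i, sdvd (super_of_nat (n i)) s]),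
      set_bij Omega (@open supernatural) X_l &
      equivalent_categories (presheaves D_cat) (sheaves supernatural)].
Proof.
split=> [I n||]; first by split; [exact: Omega_multiples|exact: X_l_multiples].
  exact: X_l_bij.
exists sections_functor, restrict_basic; split.
  exact: is_iso_isomorphic eval_trans_iso.
exact: is_iso_isomorphic_sym germs_trans_iso.
Qed.
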